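(* Let $X$ be a $T_0$ topological space. If $Q_{\upsilon}(X)$ is a $d^{*}$-space, then $X$ is a $d^{*}$-space.
   Context: For a $T_0$ space $Z$, the specialization order is $x\leq y$ iff $x\in\overline{\{y\}}$, and ${\uparrow}x=\{y\in Z\mid x\leq y\}$. A subset is saturated if it is the intersection of all open sets containing it (equivalently, an upper set in the specialization order). $Q(X)$ is the set of all nonempty compact saturated subsets of $X$, ordered by reverse inclusion ($K_1\leqslant K_2$ iff $K_2\subseteq K_1$). $Q_{\upsilon}(X)$, the Smyth power space, is $Q(X)$ with the upper Vietoris topology, generated by the sets $\Box U=\{K\in Q(X)\mid K\subseteq U\}$ for $U$ open in $X$; its specialization order is reverse inclusion. A subset of a poset is directed if it is nonempty and each of its finite subsets has an upper bound in it. A $T_0$ space $Z$ is a $d^{*}$-space if for every directed subset $D$ of $Z$ (in the specialization order), every $x\in Z$ and every nonempty open set $U\subseteq Z$, $\bigcap_{d\in D}{\uparrow}d\cap{\uparrow}x\subseteq U$ implies ${\uparrow}d\cap{\uparrow}x\subseteq U$ for some $d\in D$. *)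

(* Defs.v *)
From HB Require Import structures.
From mathcomp Require Import all_boot finmap.
From mathcomp Require Import all_classical topology.

Set Implicit Arguments.
Unset Strict Implicit.
Unset Printing Implicit Defensive.

Local Open Scope classical_set_scope.

Definition spec_le (Z : topologicalType) (x y : Z) : Prop := closure [set y] x.

Definition up (Z : topologicalType) (x : Z) : set Z := [set y | spec_le x y].

Definition directed (Z : topologicalType) (D : set Z) : Prop :=
  D !=set0 /\
  forall F : set Z, finite_set F -> F `<=` D ->
    exists2 u, D u & forall x, F x -> spec_le x u.

Definition dstar_space (Z : topologicalType) : Prop :=
  kolmogorov_space Z /\
  forall (D : set Z) (x : Z) (U : set Z),
    directed D -> open U -> U !=set0 ->
    (\bigcap_(d in D) up d) `&` up x `<=` U ->
    exists2 d, D d & up d `&` up x `<=` U.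

Definition saturated (Z : topologicalType) (A : set Z) : Prop :=
  A = \bigcap_(U in [set U | open U /\ A `<=` U]) U.

Record smyth_power (X : topologicalType) := SmythPower {
  smyth_set :> set X;
  smyth_nonempty : smyth_set !=set0;
  smyth_compact : compact smyth_set;
  smyth_saturated : saturated smyth_set
}.

Definition box (X : topologicalType) (U : set X) : set (smyth_power X) :=
  [set K : smyth_power X | K `<=` U].

HB.instance Definition _ (X : topologicalType) := gen_eqMixin (smyth_power X).
HB.instance Definition _ (X : topologicalType) :=
  gen_choiceMixin (smyth_power X).
(* The sets [box U], U open, are used as a subbase. *)
HB.instance Definition _ (X : topologicalType) :=
  @isSubBaseTopological.Build (smyth_power X) (set X) [set U | open U] (@box X).

Lemma smyth_set_inj (X : topologicalType) : injective (@smyth_set X).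
Proof.
move=> [A a1 a2 a3] [B b1 b2 b3] /= AB; subst B.
by congr SmythPower; exact: Prop_irrelevance.
Qed.

Lemma smyth_openE (X : topologicalType) (V : set (smyth_power X)) :
  open V <-> exists2 W, W `<=` finI_from [set U | open U] (@box X) &
                        \bigcup_(A in W) A = V.
Proof. by []. Qed.

Lemma open_box (X : topologicalType) (U : set X) : open U -> open (box U).
Proof.
move=> oU; apply/smyth_openE; exists [set box U]; last by rewrite bigcup_set1.
move=> _ ->; exists [fset U]%fset; first by move=> V /fset1P ->; rewrite inE.
by rewrite set_fset1 bigcap_set1.
Qed.

Lemma smyth_spec_leE (X : topologicalType) (K1 K2 : smyth_power X) :
  spec_le K1 K2 <-> K2 `<=` K1.
Proof.
split=> [K12|K21 B].
  rewrite [X in _ `<=` X]smyth_saturated => x K2x U [oU K1U].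
  have /K12 [K [-> /= K2U]] : nbhs K1 (box U).
    by apply: open_nbhs_nbhs; split=> //; exact: open_box.
  exact: K2U.
rewrite nbhsE => -[V [/smyth_openE[W sW <-] [A WA AK1]] VB].
exists K2; split=> //; apply: VB.
exists A; first exact: WA.
have [F sF AE] := sW _ WA; move: AK1; rewrite -AE => FK1 U FU.
by apply: subset_trans K21 _; exact: FK1.
Qed.

Lemma smyth_kolmogorov (X : topologicalType) : kolmogorov_space (smyth_power X).
Proof.
move=> K1 K2 /eqP K12; apply: contrapT => noA; apply: K12.
have le (K L : smyth_power X) :
    (forall A, nbhs K A -> A L) -> L `<=` K.
  by move=> KL; apply/smyth_spec_leE => A /KL AL; exists L.
apply: smyth_set_inj; apply/seteqP; split; apply: le => A nA;
    apply: contrapT => nAK; apply: noA; exists A; rewrite !inE.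
  by right.
by left.
Qed.

(* Main.v *)
(** The principal upper set [up x] is compact and saturated, and [x |-> up x]
    embeds the specialization order of [X] into that of the Smyth power space.
    Under this embedding a directed set stays directed and the hypothesis for
    [U] becomes the one for [box U]; a point [y] of [up d `&` up x] is tested
    through the compact set [up y]. *)
Require Import Defs.
From HB Require Import structures.
From mathcomp Require Import all_boot.
From mathcomp Require Import all_classical topology.

Set Implicit Arguments.
Unset Strict Implicit.
Unset Printing Implicit Defensive.

Local Open Scope classical_set_scope.

Lemma spec_leP (X : topologicalType) (x y : X) :
  spec_le x y <-> forall U : set X, nbhs x U -> U y.
Proof.
split=> [xy U /xy [_ [-> //]]|xy U /xy Uy].
by exists y.
Qed.

Lemma spec_le_refl (X : topologicalType) (x : X) : spec_le x x.
Proof. by apply/spec_leP => U /nbhs_singleton. Qed.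

Lemma spec_le_trans (X : topologicalType) (y x z : X) :
  spec_le x y -> spec_le y z -> spec_le x z.
Proof.
(* The interior of [U] is a neighbourhood of [x], so it contains [y]; hence [U] is a neighbourhood
   of [y] too. *)
move=> /spec_leP xy /spec_leP yz; apply/spec_leP => U /nbhs_interior xU.
exact: yz (xy _ xU).
Qed.

Lemma sub_up (X : topologicalType) (x y : X) :
  spec_le x y <-> up y `<=` up x.
Proof.
split=> [xy z|yx]; first exact: spec_le_trans.
exact/yx/spec_le_refl.
Qed.

Lemma open_up (X : topologicalType) (U : set X) (x y : X) :
  open U -> U x -> spec_le x y -> U y.
Proof. by move=> oU Ux /spec_leP; apply; exact: open_nbhs_nbhs. Qed.

Lemma up_nonempty (X : topologicalType) (x : X) : up x !=set0.
Proof. by exists x; exact: spec_le_refl. Qed.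

(** Every neighbourhood of [x] contains [up x], so a proper filter containing [up x] clusters at
    [x]. *)
Lemma compact_up (X : topologicalType) (x : X) : compact (up x).
Proof.
move=> F FF Fx; exists x; split; first exact: spec_le_refl.
move=> A B FA xB; have [y [Ay xy]] := filter_ex (filterI FA Fx).
by exists y; split=> //; move/spec_leP: xy; exact.
Qed.

(** Open sets containing [x] already contain [up x], so a point common to all open supersets of
    [up x] lies in every neighbourhood of [x]. *)
Lemma saturated_up (X : topologicalType) (x : X) : saturated (up x).
Proof.
apply/seteqP; split=> [y xy U [_]|y yU]; first exact.
apply/spec_leP => V; rewrite nbhsE => -[U [oU Ux]]; apply.
by apply: yU; split=> // z; exact: open_up.
Qed.

Definition smyth_up (X : topologicalType) (x : X) : smyth_power X :=
  SmythPower (up_nonempty x) (compact_up (x:=x)) (saturated_up x).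

Lemma smyth_up_le (X : topologicalType) (x y : X) :
  spec_le (smyth_up x) (smyth_up y) <-> spec_le x y.
Proof. by rewrite smyth_spec_leE sub_up. Qed.

Lemma directed_smyth_up (X : topologicalType) (D : set X) :
  directed D -> directed (@smyth_up X @` D).
Proof.
move=> [[d Dd] Dub]; split; first by exists (smyth_up d), d.
move=> F finF FD.
(* Chosen preimages pull the finite set [F] back to a finite subset of [D]; off [F] the value [d] is
   an arbitrary default. *)
have /choice[g gP] (K : smyth_power X) :
    exists x, F K -> D x /\ smyth_up x = K.
  have [/FD[x Dx <-]|nFK] := pselect (F K); first by exists x.
  by exists d => /nFK.
have [||u Du gu] := Dub (g @` F).
- exact: finite_image.
- by move=> _ [K /gP[Dg _] <-].
exists (smyth_up u); first by exists u.
move=> K FK; have [_ <-] := gP _ FK.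
by apply/smyth_up_le/gu; exists K.
Qed.

Theorem theorem3p22 (X : topologicalType) :
  kolmogorov_space X -> dstar_space (smyth_power X) -> dstar_space X.
Proof.
move=> T0X [_ dstarQ]; split=> // D x U dirD oU [u Uu] DxU.
have [||||_ [d Dd <-] dxU] :=
  dstarQ (@smyth_up X @` D) (smyth_up x) (box U).
- exact: directed_smyth_up.
- exact: open_box.
- by exists (smyth_up u) => y; exact: open_up.
(* As [K] is contained in [up x] and in every [up d], each of its points falls under [DxU]. *)
- move=> K [DK /smyth_spec_leE xK] y Ky; apply: DxU; split; last exact: xK.
  move=> d Dd; have /smyth_spec_leE : spec_le (smyth_up d) K.
    by apply: DK; exists d.
  exact.
exists d => // y [dy xy].
have yU : box U (smyth_up y) by apply: dxU; split; exact/smyth_up_le.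
exact/yU/spec_le_refl.
Qed.
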